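(* Let $(\mathbf{Z},\mathbf{f})$ be a world input-output table with adjacency input matrix $\mathbf{A}$ and adjacency output matrix $\mathbf{B}$, satisfying the standing assumptions in the context. Let $\boldsymbol{\rho}^l(\cdot)$ and $\boldsymbol{\rho}^r(\cdot)$ denote the positive left and right dominant eigenvectors of the indicated matrix, normalized so that $\sum_i\rho_i^l(\cdot)=1$ and $\sum_i\rho_i^l(\cdot)\rho_i^r(\cdot)=1$. Then $$\rho_i^l(\mathbf{A})\,\rho_i^r(\mathbf{A})=\rho_i^l(\mathbf{B})\,\rho_i^r(\mathbf{B})\quad\text{for all } i\in V.$$
   Context: Let $n\ge1$, $V=\{1,\dots,n\}$. A world input-output table consists of a nonnegative $n\times n$ matrix $\mathbf{Z}=[z_{ij}]$ (intermediate sales from $i$ to $j$) and a nonnegative vector $\mathbf{f}=[f_1,\dots,f_n]^T$ (final demand). The gross output is $x_i=\sum_j z_{ij}+f_i$ and the value added is $w_i=x_i-\sum_j z_{ji}$. The adjacency input matrix is $\mathbf{A}=[a_{ij}]$ with $a_{ij}=z_{ij}/x_j$; the adjacency output matrix is $\mathbf{B}=[b_{ij}]$ with $b_{ij}=z_{ij}/x_i$. Standing assumptions: $x_i>0$ and $w_i\ge0$ for all $i$; the network is irreducible, i.e. for all $i,j\in V$ there is $k\ge1$ with $(\mathbf{Z}^k)_{ij}>0$; and $\lambda<1$, where $\lambda$ is the largest (Perron-Frobenius) eigenvalue, which is the same for $\mathbf{A}$ and $\mathbf{B}$ since $\mathbf{B}=\mathbf{X}_{dg}^{-1}\mathbf{A}\mathbf{X}_{dg}$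 with $\mathbf{X}_{dg}=\mathrm{diag}(x_1,\dots,x_n)$. For a matrix $\mathbf{M}\in\{\mathbf{A},\mathbf{B}\}$, the right and left dominant eigenvectors are the (entrywise positive) column vectors satisfying $\mathbf{M}\boldsymbol{\rho}^r=\lambda\boldsymbol{\rho}^r$ and $(\boldsymbol{\rho}^l)^T\mathbf{M}=\lambda(\boldsymbol{\rho}^l)^T$. The vector $[\rho_i^l\rho_i^r]_i$ is called the (quasi-stationary) product distribution. *)

(* Defs.v *)
From HB Require Import structures.
From mathcomp Require Import all_boot all_order all_algebra.
From mathcomp Require Import reals.
From mathcomp.real_closed Require Import complex.

Set Implicit Arguments.
Unset Strict Implicit.
Unset Printing Implicit Defensive.

Import Order.TTheory GRing.Theory Num.Theory.
Local Open Scope ring_scope.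
Local Open Scope complex_scope.

Definition io_table (R : realType) (n : nat) (Z : 'M[R]_n) (f : 'cV[R]_n) : Prop :=
  (forall i j, 0 <= Z i j) /\ (forall i, 0 <= f i 0).

Definition gross_output (R : realType) (n : nat) (Z : 'M[R]_n) (f : 'cV[R]_n) : 'cV[R]_n :=
  \col_i (\sum_j Z i j + f i 0).

Definition value_added (R : realType) (n : nat) (Z : 'M[R]_n) (f : 'cV[R]_n) : 'cV[R]_n :=
  \col_i (gross_output Z f i 0 - \sum_j Z j i).

Definition input_matrix (R : realType) (n : nat) (Z : 'M[R]_n) (f : 'cV[R]_n) : 'M[R]_n :=
  \matrix_(i, j) (Z i j / gross_output Z f j 0).

Definition output_matrix (R : realType) (n : nat) (Z : 'M[R]_n) (f : 'cV[R]_n) : 'M[R]_n :=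
  \matrix_(i, j) (Z i j / gross_output Z f i 0).

Definition irreducible_mx (R : realType) (n : nat) (M : 'M[R]_n) : Prop :=
  forall i j, exists k : nat, (0 < k)%N /\ 0 < (M ^+ k) i j.

(* The largest eigenvalue in the Perron-Frobenius sense: a real eigenvalue
   that bounds the modulus of every complex eigenvalue. *)
Definition dominant_eigenvalue (R : realType) (n : nat) (M : 'M[R]_n) (lambda : R) : Prop :=
  eigenvalue M lambda /\
  forall mu : R[i], eigenvalue (map_mx (real_complex R) M) mu -> `|mu| <= lambda%:C.

Definition right_dominant_eigenvector (R : realType) (n : nat) (M : 'M[R]_n)
    (rho : 'cV[R]_n) : Prop :=
  (forall i, 0 < rho i 0) /\
  exists2 lambda, dominant_eigenvalue M lambda & M *m rho = lambda *: rho.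

Definition left_dominant_eigenvector (R : realType) (n : nat) (M : 'M[R]_n)
    (rho : 'cV[R]_n) : Prop :=
  (forall i, 0 < rho i 0) /\
  exists2 lambda, dominant_eigenvalue M lambda & rho^T *m M = lambda *: rho^T.

Definition normalized_dominant_pair (R : realType) (n : nat) (M : 'M[R]_n)
    (rhol rhor : 'cV[R]_n) : Prop :=
  [/\ left_dominant_eigenvector M rhol,
      right_dominant_eigenvector M rhor,
      \sum_i rhol i 0 = 1
    & \sum_i rhol i 0 * rhor i 0 = 1].

(* Main.v *)
Require Import Defs.
From HB Require Import structures.
From mathcomp Require Import all_boot all_order all_algebra.
From mathcomp Require Import reals.
From mathcomp.real_closed Require Import complex.

Import Order.TTheory GRing.Theory Num.Theory.
Local Open Scope ring_scope.

(** Since [B = X^-1 A X] with [X = diag x], the vectors [X^-1 rhol(B)] and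
[X rhor(B)] are left and right eigenvectors of [A]. Pairing positive left and
right eigenvectors forces a common eigenvalue, and for an irreducible
nonnegative matrix the eigenvectors belonging to an eigenvalue with a positive
eigenvector form a line. So the two products are proportional (the factors [x]
and [x^-1] cancel), and both sum to 1. *)

(** A positive entry of [M ^+ k] comes from a walk of [k] steps along positive entries of [M];
    induction on [k] carries [P] along it, one first step at a time. *)
Lemma irreducible_mx_trans_closed {R : realType} {n : nat} {M : 'M[R]_n}
    (P : 'I_n -> Prop) :
  (forall i j, 0 <= M i j) -> irreducible_mx M ->
  (forall i j, 0 < M i j -> P i -> P j) -> forall i j, P i -> P j.
Proof.
move=> M_ge0 irrM closedP i j Pi; have [k [_]] := irrM i j.
(* The induction starts at the identity [M ^+ 0], where a positive entry forces [i = j]. *)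
elim: k i Pi => [|k IHk] i Pi.
  by rewrite expr0 mxE; case: eqP => [<-|]; rewrite ?ltxx.
rewrite exprS mxE => sum_gt0.
have [l] : exists l, 0 < M i l * (M ^+ k) l j.
  apply/existsP; apply: contraLR sum_gt0; rewrite negb_exists => /forallP le0.
  by rewrite -leNgt; apply: sumr_le0 => l _; rewrite leNgt.
have := M_ge0 i l; rewrite le0r => /orP[/eqP->|Mil_gt0].
  by rewrite mul0r ltxx.
by rewrite pmulr_rgt0 //; apply/IHk/(closedP i).
Qed.

Lemma trmx_exp {R : comPzRingType} {n : nat} (M : 'M[R]_n) k :
  (M ^+ k)^T = M^T ^+ k.
Proof.
elim: k => [|k IHk]; first by rewrite !expr0 trmx1.
by rewrite exprS exprSr -IHk; apply: trmx_mul.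
Qed.

Lemma irreducible_mx_tr {R : realType} {n : nat} {M : 'M[R]_n} :
  irreducible_mx M -> irreducible_mx M^T.
Proof.
move=> irrM i j; have [k [k_gt0 Mk_gt0]] := irrM j i.
by exists k; rewrite -trmx_exp mxE.
Qed.

(* Subtracting from [u] the largest multiple of [v] that lies below it leaves a
nonnegative eigenvector with a zero entry; its zero set is closed under the
edges of [Z], hence is everything. *)
Lemma irreducible_eigenvector_unique {R : realType} {n : nat} {Z M : 'M[R]_n}
    {lambda : R} {u v : 'cV[R]_n} :
  (forall i j, 0 <= Z i j) -> irreducible_mx Z ->
  (forall i j, 0 <= M i j) -> (forall i j, 0 < Z i j -> 0 < M i j) ->
  (forall i, 0 < v i 0) -> M *m v = lambda *: v -> M *m u = lambda *: u ->
  exists c, u = c *: v.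
Proof.
case: n => [|n] in Z M u v *; first by exists 0; apply/colP => -[].
move=> Z_ge0 irrZ M_ge0 ZM v_gt0 Mv Mu.
(* The least ratio is the largest [c] with [c *: v] below [u] entrywise, and equality holds where it
   is attained. *)
pose F (i : 'I_n.+1) := u i 0 / v i 0.
have [i0 _ F_min] := @Order.TotalTheory.arg_minP _ _ _ ord0 predT F isT.
exists (F i0); have [w Dw] : {w | w = u - F i0 *: v} by exists (u - F i0 *: v).
have w_ge0 j : 0 <= w j 0.
  by rewrite Dw !mxE subr_ge0 -ler_pdivlMr // F_min.
have w0 : w i0 0 = 0.
  by rewrite Dw !mxE mulfVK ?subrr // gt_eqF.
have Mw : M *m w = lambda *: w.
  by rewrite Dw mulmxBr -scalemxAr Mu Mv scalerBr !scalerA mulrC.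
apply/eqP; rewrite -subr_eq0 -Dw; apply/eqP/colP => j; rewrite [RHS]mxE.
apply: (irreducible_mx_trans_closed (fun j => w j 0 = 0) Z_ge0 irrZ _ i0 j w0).
(* Where [w] vanishes at [i], row [i] of [Mw] is a zero sum of nonnegative terms, so each term is
   zero. *)
move=> i k /ZM Mik_gt0 wi; have /matrixP/(_ i 0) := Mw.
rewrite !mxE wi mulr0 => sum0.
have /eqP : M i k * w k 0 = 0.
  by apply: (psumr_eq0P _ sum0) => // l _; rewrite mulr_ge0.
by rewrite mulf_eq0 gt_eqF //= => /eqP.
Qed.

(** Evaluate [l^T *m M *m r] in both ways; the scalar [l^T *m r] is positive and cancels. *)
Lemma positive_left_right_eigenvalue_eq {R : realType} {n : nat} {M : 'M[R]_n}
    {a b : R} {l r : 'cV[R]_n} :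
  (0 < n)%N -> (forall i, 0 < l i 0) -> (forall i, 0 < r i 0) ->
  l^T *m M = a *: l^T -> M *m r = b *: r -> a = b.
Proof.
case: n => // n in M l r * => _ l_gt0 r_gt0 lM Mr.
have lr_gt0 : 0 < (l^T *m r) 0 0.
  rewrite mxE big_ord_recl ltr_pwDl ?mxE ?mulr_gt0 // sumr_ge0 // => i _.
  by rewrite mxE ltW ?mulr_gt0.
have : a *: (l^T *m r) = b *: (l^T *m r).
  by rewrite scalemxAl -lM -mulmxA Mr scalemxAr.
move/matrixP/(_ 0 0); rewrite mxE [RHS]mxE => /mulIf; apply.
by rewrite gt_eqF.
Qed.

Theorem theorem2 (R : realType) (n : nat) (hn : (1 <= n)%N)
    (Z : 'M[R]_n) (f : 'cV[R]_n) (lambda : R)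
    (rholA rhorA rholB rhorB : 'cV[R]_n)
    (htable : io_table Z f)
    (hx : forall i, 0 < gross_output Z f i 0)
    (hw : forall i, 0 <= value_added Z f i 0)
    (hirr : irreducible_mx Z)
    (hlambda : dominant_eigenvalue (input_matrix Z f) lambda)
    (hlambda1 : lambda < 1)
    (hA : normalized_dominant_pair (input_matrix Z f) rholA rhorA)
    (hB : normalized_dominant_pair (output_matrix Z f) rholB rhorB) :
  forall i, rholA i 0 * rhorA i 0 = rholB i 0 * rhorB i 0.
Proof.
move=> i; have [Z_ge0 _] := htable.
set x := gross_output Z f in hx.
have x_neq0 j : x j 0 != 0 by rewrite gt_eqF.
case: hA => -[lA_gt0 [a1 _ lA]] [rA_gt0 [a2 _ rA]] _ sumA.
case: hB => -[lB_gt0 [b1 _ lB]] [rB_gt0 [b2 _ rB]] _ sumB.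
set A := input_matrix Z f in lA rA; set B := output_matrix Z f in lB rB.
have AE j k : A j k = Z j k / x k 0 by rewrite mxE.
have BE j k : B j k = Z j k / x j 0 by rewrite mxE.
clearbody x A B.
have A_ge0 j k : 0 <= A j k by rewrite AE divr_ge0 // ltW.
have A_gt0 j k : 0 < Z j k -> 0 < A j k by move=> ?; rewrite AE divr_gt0.
pose r : 'cV[R]_n := \col_j (x j 0 * rhorB j 0).
pose l : 'cV[R]_n := \col_j (rholB j 0 / x j 0).
have r_gt0 j : 0 < r j 0 by rewrite mxE mulr_gt0.
have l_gt0 j : 0 < l j 0 by rewrite mxE divr_gt0.
(* Entrywise, [A j k * x k] and [x j * B j k] both equal [Z j k]. *)
have Ar : A *m r = b2 *: r.
  apply/colP => j; move/colP/(_ j): rB; rewrite !mxE mulrCA => <-.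
  rewrite mulr_sumr; apply: eq_bigr => k _.
  by rewrite !mxE AE BE mulrA divfK // mulrA mulrCA divff // mulr1.
have Al : l^T *m A = b1 *: l^T.
  apply/rowP => j; move/rowP/(_ j): lB; rewrite !mxE mulrA => <-.
  rewrite mulr_suml; apply: eq_bigr => k _.
  by rewrite !mxE AE BE !mulrA; congr (_ / _); rewrite mulrAC.
(* Three pairings of a left with a right eigenvector of [A] link all four eigenvalues. *)
have a12 := positive_left_right_eigenvalue_eq hn lA_gt0 rA_gt0 lA rA.
have a1b2 := positive_left_right_eigenvalue_eq hn lA_gt0 r_gt0 lA Ar.
have b12 := positive_left_right_eigenvalue_eq hn l_gt0 r_gt0 Al Ar.
move: rA lA Al; rewrite -a12 a1b2 b12 => rA lA Al.
have [c rAE] := irreducible_eigenvector_unique Z_ge0 hirr A_ge0 A_gt0 r_gt0 Ar rA.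
(* Left eigenvectors of [A] are right eigenvectors of [A^T], whose positive entries follow the
   reversed edges [Z^T]. *)
have [d lAE] : exists d, rholA = d *: l.
  apply: (@irreducible_eigenvector_unique _ _ Z^T A^T b2) => //.
  - by move=> j k; rewrite mxE.
  - exact: irreducible_mx_tr.
  - by move=> j k; rewrite mxE.
  - by move=> j k; rewrite [Z^T _ _]mxE [A^T _ _]mxE; apply: A_gt0.
  - by apply: trmx_inj; rewrite trmx_mul trmxK linearZ.
  - by apply: trmx_inj; rewrite trmx_mul trmxK linearZ.
have prodE j : rholA j 0 * rhorA j 0 = d * c * (rholB j 0 * rhorB j 0).
  by rewrite rAE lAE !mxE mulrACA; congr (_ * _); rewrite mulrA divfK.
(* Summing [prodE] over [j] turns the two normalizations into [d * c = 1]. *)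
move: sumA; rewrite (eq_bigr _ (fun j _ => prodE j)) -mulr_sumr sumB mulr1 => dc1.
by rewrite prodE dc1 mul1r.
Qed.
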